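(* Let $n\ge1$ be an integer. For every $p\in(1,\infty)$ and every $f\colon\{-1,1\}^n\to\mathbb{R}$ with $\mathbb{E}f=0$, $$\mathbb{E}\left[|f|^{p-1}\,\mathrm{sign}(f)\,Lf\right]\ \ge\ \frac{2p-2}{p^2-2p+2}\cdot\mathbb{E}|f|^p .$$
   Context: $\{-1,1\}^n$ carries the uniform probability measure and $\mathbb{E}$ is expectation with respect to it. For $S\subseteq\{1,\ldots,n\}$ and $x\in\{-1,1\}^n$ put $W_S(x)=\prod_{i\in S}x_i$ and $\widehat f(S)=\mathbb{E}[fW_S]$, so $f=\sum_S\widehat f(S)W_S$. The operator $L$ is $Lf=\sum_{S\subseteq\{1,\ldots,n\}}|S|\,\widehat f(S)W_S$. The function $|f|^{p-1}\mathrm{sign}(f)$ is $0$ where $f=0$. *)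

(* Defs.v *)
From mathcomp Require Import all_boot all_order all_algebra.
From mathcomp Require Import reals exp.

Set Implicit Arguments.
Unset Strict Implicit.
Unset Printing Implicit Defensive.

Import Order.TTheory GRing.Theory Num.Theory.
Local Open Scope ring_scope.

(* A point of {-1,1}^n is encoded by its sign pattern: [true] at index i
   stands for the coordinate -1 and [false] for +1 (see [cube_coord]). *)
Definition cube (n : nat) : finType := {ffun 'I_n -> bool}.

Definition cube_coord (R : realType) (n : nat) (x : cube n) (i : 'I_n) : R :=
  (-1) ^+ x i.

Definition mean (R : realType) (n : nat) (f : cube n -> R) : R :=
  (\sum_(x : cube n) f x) / #|cube n|%:R.

Definition walsh (R : realType) (n : nat) (S : {set 'I_n}) (x : cube n) : R :=
  \prod_(i in S) cube_coord R x i.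

Definition fourier (R : realType) (n : nat) (f : cube n -> R)
    (S : {set 'I_n}) : R :=
  mean (fun x => f x * walsh R S x).

Definition Lop (R : realType) (n : nat) (f : cube n -> R) (x : cube n) : R :=
  \sum_(S : {set 'I_n}) #|S|%:R * fourier f S * walsh R S x.

(* Main.v *)
(** Put [s = (p - 2) / p] and [h = |f|^(p/2) sign f], so that [h^2 = |f|^p].
    Pointwise, [(a - b) (g a - g b) >= (1 - s^2) (h a - h b)^2], where [g] and
    [h] denote the signed powers of exponents [p - 1] and [p / 2]; summing over
    the edges of the cube and applying the Poincare inequality to [h] gives
    [E (g f * L f) >= (1 - s^2) Var h]. The mean of [h] does not vanish, but
    [E f = 0] forces [(E h)^2 <= s^2 / (1 + s^2) * E h^2]: decomposing the law
    of [f] into centred two-point laws reduces this to an inequality in two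
    variables. The constant obtained is [(1 - s^2) / (1 + s^2)]. Both
    two-variable inequalities come down, in exponential coordinates, to
    [|sinh (s z)| <= |s| |sinh z|] for [|s| <= 1]. *)

Require Import Defs.
From mathcomp Require Import all_boot all_order all_algebra.
From mathcomp Require Import reals topology normedtype sequences derive exp.
From mathcomp Require Import ring lra.

Import Order.TTheory GRing.Theory Num.Theory.
Import numFieldNormedType.Exports.
Local Open Scope ring_scope.

(** * Comparison of hyperbolic sines *)

(** The difference of the two sides vanishes at [0] and has derivative
    [2 k (cosh x - cosh (k x)) >= 0]. *)
Lemma expR_sinh_le (R : realType) (k x : R) : 0 <= k <= 1 -> 0 <= x ->
  expR (k * x) - expR (- (k * x)) <= k * (expR x - expR (- x)).
Proof.
move=> /andP[k0 k1] x0.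
pose g (y : R) := k * (expR y - expR (- y)) - (expR (k * y) - expR (- (k * y))).
have dg (y : R) : is_derive y (1 : R) g
    (k * (expR y + expR (- y)) - k * (expR (k * y) + expR (- (k * y)))).
  by rewrite /g; apply: is_derive_eq; rewrite /GRing.scale /=; ring.
have g0 : g 0 = 0 by rewrite /g mulr0 oppr0; ring.
suff : g 0 <= g x by rewrite g0 /g subr_ge0.
apply: (@ger0_derive1_le_cc _ g 0 x _ _ _ 0 x _ _ x0).
- by move=> y _; case: (dg y).
- move=> y; rewrite in_itv /= => /andP[y0 yx].
  rewrite derive1E (@derive_val _ _ _ _ _ _ _ (dg y)) -mulrBr; apply: mulr_ge0 => //.
  have ky0 : 0 <= k * y by rewrite mulr_ge0 // ltW.
  have kyy : k * y <= y by rewrite ler_piMl // ltW.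
  rewrite !expRN.
  have X1 : 1 <= expR (k * y) by rewrite -expR0 ler_expR.
  have XY : expR (k * y) <= expR y by rewrite ler_expR.
  set X := expR (k * y) in X1 XY *; set Y := expR y in XY *.
  (* Both factors are nonnegative since [1 <= X <= Y]. *)
  have -> : Y + Y^-1 - (X + X^-1) = (Y - X) * (1 - X^-1 * Y^-1).
    by field; rewrite !gt_eqF //; lra.
  rewrite mulr_ge0 ?subr_ge0 // -invfM invf_le1 ?mulr_gt0 //; try lra.
  nra.
- by apply: derivable_within_continuous => y _; exact: ex_derive.
- by rewrite in_itv /= lexx x0.
- by rewrite in_itv /= lexx x0.
Qed.

Lemma sqr_expR_sinh_le (R : realType) (s z : R) : `|s| <= 1 ->
  (expR (s * z) - expR (- (s * z))) ^+ 2 <=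
  s ^+ 2 * (expR z - expR (- z)) ^+ 2.
Proof.
wlog z0 : z / 0 <= z => [H s1|].
  have [z0|/ltW z0] := leP 0 z; first exact: H.
  have := H (- z); rewrite oppr_ge0 mulrN !opprK => /(_ z0 s1).
  by rewrite -(sqrrN (_ - expR (s * z))) -(sqrrN (_ - expR z)) !opprB.
wlog s0 : s / 0 <= s => [H s1|].
  have [s0|/ltW s0] := leP 0 s; first exact: H.
  have := H (- s); rewrite oppr_ge0 normrN mulNr !opprK sqrrN => /(_ s0 s1).
  by rewrite -(sqrrN (_ - expR (s * z))) !opprB.
rewrite ger0_norm // => s1; rewrite -exprMn lerXn2r //.
- by rewrite nnegrE subr_ge0 ler_expR; nra.
- by rewrite nnegrE mulr_ge0 // subr_ge0 ler_expR; lra.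
- by apply: expR_sinh_le; rewrite ?s0.
Qed.

(** * Two-variable inequalities for powers *)

(** For [a = e^u], [b = e^v], [z = p (u - v) / 4] and [y = (p - 2) / p * z], the middle term is a
    positive multiple of [sinh(y)^2] and the right-hand side is the same multiple of
    [((p - 2) / p)^2 sinh(z)^2]. *)
Lemma powR_heinz (R : realType) (p a b : R) : 1 < p -> 0 <= a -> 0 <= b ->
  0 <= a * b `^ (p - 1) + b * a `^ (p - 1) - 2 * (a `^ (p / 2) * b `^ (p / 2))
    <= ((p - 2) / p) ^+ 2 * (a `^ (p / 2) - b `^ (p / 2)) ^+ 2.
Proof.
move=> p1; have p10 : p - 1 != 0 by apply/eqP; lra.
have p20 : p / 2 != 0 by apply/eqP; lra.
rewrite [0 <= a]le0r [0 <= b]le0r => /orP[/eqP->|a0] /orP[/eqP->|b0];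
  rewrite ?powR0 // ?(mulr0, mul0r, addr0, subr0) ?lexx -?exprMn
    ?sqr_ge0 //.
pose u := ln a; pose v := ln b.
pose m := p * (u + v) / 4; pose z := p * (u - v) / 4; pose y := (p - 2) / p * z.
have Ea r : a `^ r = expR (r * u) by rewrite /powR (gt_eqF a0).
have Eb r : b `^ r = expR (r * v) by rewrite /powR (gt_eqF b0).
have e1 : a * b `^ (p - 1) = expR m ^+ 2 * expR (- y) ^+ 2.
  rewrite -{1}(powRr1 (ltW a0)) Ea Eb -!expRM_natl -!expRD; congr expR.
  by rewrite /m /y /z; field; lra.
have e2 : b * a `^ (p - 1) = expR m ^+ 2 * expR y ^+ 2.
  rewrite -{1}(powRr1 (ltW b0)) Ea Eb -!expRM_natl -!expRD; congr expR.
  by rewrite /m /y /z; field; lra.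
have e3 : a `^ (p / 2) = expR m * expR z.
  by rewrite Ea -expRD; congr expR; rewrite /m /z; field.
have e4 : b `^ (p / 2) = expR m * expR (- z).
  by rewrite Eb -expRD; congr expR; rewrite /m /z; field.
rewrite e1 e2 e3 e4.
have zz : expR z * expR (- z) = 1 by rewrite -expRD subrr expR0.
have yy : expR y * expR (- y) = 1 by rewrite -expRD subrr expR0.
have -> : expR m ^+ 2 * expR (- y) ^+ 2 + expR m ^+ 2 * expR y ^+ 2 -
    2 * (expR m * expR z * (expR m * expR (- z))) =
    expR m ^+ 2 * (expR y - expR (- y)) ^+ 2.
  ring: zz yy.
have -> : ((p - 2) / p * (expR m * expR z - expR m * expR (- z))) ^+ 2 =
    expR m ^+ 2 * (((p - 2) / p) ^+ 2 * (expR z - expR (- z)) ^+ 2) by ring.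
rewrite mulr_ge0 ?sqr_ge0 //= ler_wpM2l ?sqr_ge0 // sqr_expR_sinh_le //.
by rewrite ler_norml ler_pdivlMr ?ler_pdivrMr; lra.
Qed.

Definition signed_powR {R : realType} (r a : R) : R := `|a| `^ r * Num.sg a.

Lemma ge0_signed_powR (R : realType) (r a : R) : r != 0 -> 0 <= a ->
  signed_powR r a = a `^ r.
Proof.
move=> r0; rewrite /signed_powR le0r => /orP[/eqP->|a0].
  by rewrite sgr0 mulr0 powR0.
by rewrite gtr0_norm // gtr0_sg // mulr1.
Qed.

Lemma signed_powRN (R : realType) (r a : R) :
  signed_powR r (- a) = - signed_powR r a.
Proof. by rewrite /signed_powR normrN sgrN mulrN. Qed.

Lemma sqr_powR_half (R : realType) (p a : R) : 1 < p ->
  (a `^ (p / 2)) ^+ 2 = a `^ p.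
Proof.
move=> p1; rewrite expr2 -powRD; first by congr (_ `^ _); field.
by apply/implyP => /eqP; lra.
Qed.

Lemma sqr_signed_powR_half (R : realType) (p a : R) : 1 < p ->
  signed_powR (p / 2) a ^+ 2 = `|a| `^ p.
Proof.
move=> p1; rewrite /signed_powR exprMn sqr_powR_half // sqr_sg.
have [->|_] := eqVneq a 0; last by rewrite mulr1.
by rewrite mulr0 normr0 powR0 //; apply/eqP; lra.
Qed.

(* Stroock-Varopoulos; note [1 - ((p - 2) / p) ^ 2 = 4 (p - 1) / p ^ 2]. *)
Lemma stroock_varopoulos (R : realType) (p a b : R) : 1 < p ->
  (1 - ((p - 2) / p) ^+ 2) *
    (signed_powR (p / 2) a - signed_powR (p / 2) b) ^+ 2 <=
  (a - b) * (signed_powR (p - 1) a - signed_powR (p - 1) b).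
Proof.
move=> p1; have p10 : p - 1 != 0 by apply/eqP; lra.
have p20 : p / 2 != 0 by apply/eqP; lra.
have p0 : 0 < p by lra.
(* The inequality is invariant under [(a, b) -> (- b, - a)] and under swapping [a] and [b]. *)
wlog ab : a b / 0 <= a + b => [H|].
  have [|/ltW ab] := leP 0 (a + b); first exact: H.
  have := H (- b) (- a); rewrite -opprD oppr_ge0 addrC !signed_powRN => /(_ ab).
  by rewrite !opprK !(addrC (- _)).
wlog a0 : a b ab / 0 <= a => [H|].
  have [|/ltW a0] := leP 0 a; first exact: H.
  have := H b a; rewrite addrC => /(_ ab).
  have b0 : 0 <= b by lra.
  move=> /(_ b0); rewrite -(sqrrN (signed_powR _ b - _)) opprB.
  by rewrite -(mulrNN (b - a)) !opprB.
(* Equal signs use the upper bound of [powR_heinz], opposite signs only its lower bound. *)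
have [b0|b0] := leP 0 b.
  rewrite !ge0_signed_powR //.
  have := powR_heinz R p a b p1 a0 b0.
  have := mulr_powRB1 a0 p0; have := mulr_powRB1 b0 p0.
  rewrite -(sqr_powR_half R p a p1) -(sqr_powR_half R p b p1).
  set A := a `^ (p / 2); set B := b `^ (p / 2).
  set A' := a `^ (p - 1); set B' := b `^ (p - 1).
  by move=> hB hA /andP[_]; move: (((p - 2) / p) ^+ 2) => s2; lra.
have [c bc] : exists c, b = - c by exists (- b); rewrite opprK.
move: b0; rewrite {b ab}bc !signed_powRN oppr_lt0 !opprK => /ltW; move: c => b b0.
rewrite !ge0_signed_powR //.
have /andP[+ _] := powR_heinz R p a b p1 a0 b0.
have := mulr_powRB1 a0 p0; have := mulr_powRB1 b0 p0.
rewrite -(sqr_powR_half R p a p1) -(sqr_powR_half R p b p1).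
set A := a `^ (p / 2); set B := b `^ (p / 2).
set A' := a `^ (p - 1); set B' := b `^ (p - 1).
move=> hB hA.
have := mulr_ge0 (sqr_ge0 ((p - 2) / p)) (sqr_ge0 (A + B)).
move: (((p - 2) / p) ^+ 2) => s2. lra.
Qed.

(** * The mean of a signed power of a centred function *)

(** For two-point centred laws, [(1 + s2) (E h)^2 <= s2 E h^2], with [(E h)^2] replaced by its
    minorant [2 t E h - t^2]: this is linear in the law, so it passes to mixtures with a common
    [t]. *)
Lemma two_point_signed_powR (R : realType) (p t a c : R) :
  let s2 := ((p - 2) / p) ^+ 2 in let h := signed_powR (p / 2) in
  1 < p -> 0 <= a -> c < 0 ->
  (1 + s2) * (2 * t * (a * h c - c * h a)) <=
  s2 * (a * h c ^+ 2 - c * h a ^+ 2) + (1 + s2) * (t ^+ 2 * (a - c)).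
Proof.
move=> s2 h p1 a0 c0.
have p20 : p / 2 != 0 by apply/eqP; lra.
have p0 : 0 < p by lra.
have [b bc] : exists b, c = - b by exists (- c); rewrite opprK.
move: c0; rewrite {c}bc /h !signed_powRN oppr_lt0 => b0.
rewrite !ge0_signed_powR ?(ltW b0) //.
have := powR_heinz R p a b p1 a0 (ltW b0).
have := mulr_powRB1 a0 p0; have := mulr_powRB1 (ltW b0) p0.
rewrite -(sqr_powR_half R p a p1) -(sqr_powR_half R p b p1) -/s2.
have : 0 <= s2 := sqr_ge0 _.
have := powR_ge0 a (p / 2); have := powR_ge0 b (p / 2).
move: s2 (a `^ (p / 2)) (b `^ (p / 2)) (a `^ (p - 1)) (b `^ (p - 1)).
move=> s2 A B A' B' B0 A0 s0 hB hA /andP[_ hz].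
(* With masses [b] at [a] and [a] at [- b], [D] and the later [Q] are the unnormalised means of [h]
   and [h^2]. *)
set D := b * A - a * B.
have D2 : D ^+ 2 <= a * b * s2 * (A + B) ^+ 2.
  have -> : D ^+ 2 = a * b * (a * B' + b * A' - 2 * (A * B)).
    rewrite /D; have -> : (b * A - a * B) ^+ 2 =
      b ^+ 2 * A ^+ 2 + a ^+ 2 * B ^+ 2 - 2 * (a * b * (A * B)) by ring.
    by rewrite -hA -hB; ring.
  rewrite -[leRHS]mulrA ler_wpM2l ?mulr_ge0 ?(ltW b0) // (le_trans hz) //.
  by rewrite ler_wpM2l //; have := mulr_ge0 A0 B0; lra.
set Q := b * A ^+ 2 + a * B ^+ 2.
(* Second moment as squared mean plus variance; the bound on [D ^+ 2] is a multiple of this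
   variance. *)
have QE : Q * (a + b) = D ^+ 2 + a * b * (A + B) ^+ 2 by rewrite /Q /D; ring.
have {}D2 : (1 + s2) * D ^+ 2 <= s2 * (Q * (a + b)) by rewrite QE; lra.
have ab0 : 0 < a + b by lra.
have -> : a * - B - - b * A = D by rewrite /D; ring.
have -> : a * (- B) ^+ 2 - - b * A ^+ 2 = Q by rewrite /Q; ring.
rewrite opprK -(ler_pM2r ab0).
have := mulr_ge0 (addr_ge0 ler01 s0) (sqr_ge0 (D - t * (a + b))).
move: D2; clearbody D Q; clear -s0; lra.
Qed.

(* A centred law is a mixture of centred laws supported on two points [c < 0 <= a];
   up to normalisation, such a law has masses [- c] at [a] and [a] at [c]. *)
Lemma sum_ge0_centred_two_point (R : realFieldType) (T : finType) (f : T -> R)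
    (phi : R -> R) : \sum_x f x = 0 ->
  (forall a c, 0 <= a -> c < 0 -> 0 <= a * phi c - c * phi a) ->
  0 <= \sum_x phi (f x).
Proof.
move=> f0 H.
(* The pair [a = 0], [c = -1] isolates [phi 0], which settles the case where [f] vanishes
   identically. *)
have phi0 : 0 <= phi 0 by have := H 0 (-1) (lexx _) (ltrN10 _); lra.
rewrite (bigID (fun x => f x < 0)) /= in f0.
case: (pickP (fun y => f y < 0)) => [y0 fy0|fge0]; last first.
  move: f0; rewrite big_pred0 // add0r => /eqP.
  rewrite psumr_eq0 => [/allP f0|x]; last by rewrite -leNgt.
  apply: sumr_ge0 => x _; have := f0 x; rewrite mem_index_enum fge0 => /(_ isT).
  by move=> /eqP->.
set M := \sum_(x | ~~ (f x < 0)) f x in f0.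
have M0 : 0 < M.
  move: f0; rewrite (bigD1 y0) //=.
  have : \sum_(i | (f i < 0) && (i != y0)) f i <= 0.
    by apply: sumr_le0 => i /andP[/ltW].
  lra.
rewrite -(pmulr_rge0 _ M0).
(* [M] is also the total of [- f] over the negative values, so each half of the sum becomes a double
   sum over pairs. *)
have -> : M * \sum_x phi (f x) =
    \sum_(x | ~~ (f x < 0)) \sum_(y | f y < 0) (f x * phi (f y) - f y * phi (f x)).
  rewrite (bigID (fun x => f x < 0)) /= mulrDr {1}/M big_distrlr /=.
  have -> : M = - \sum_(x | f x < 0) f x by lra.
  rewrite mulNr big_distrlr /= [X in _ - X]exchange_big /= -sumrB.
  by apply: eq_bigr => x _; rewrite -sumrB.
apply: sumr_ge0 => x; rewrite -leNgt => fx; apply: sumr_ge0 => y fy.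
exact: H.
Qed.

Lemma card_cube_neq0 (R : realType) (n : nat) : #|cube n|%:R != 0 :> R.
Proof. by rewrite card_ffun card_bool card_ord pnatr_eq0 expn_eq0. Qed.

Lemma sqr_mean_signed_powR (R : realType) (n : nat) (p : R) (f : cube n -> R) :
  let s2 := ((p - 2) / p) ^+ 2 in 1 < p -> mean f = 0 ->
  (1 + s2) * mean (fun x => signed_powR (p / 2) (f x)) ^+ 2 <=
  s2 * mean (fun x => `|f x| `^ p).
Proof.
move=> s2 p1 mf0; have f0 : \sum_x f x = 0.
  by move/eqP: mf0; rewrite mulf_eq0 invr_eq0 (negbTE (card_cube_neq0 _ _)) orbF
    => /eqP.
set t := mean (fun x => signed_powR _ _); set N : R := #|cube n|%:R.
pose h := signed_powR (p / 2).
have tN : \sum_x h (f x) = t * N by rewrite /t /mean divfK ?card_cube_neq0.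
have N0 : 0 < N by rewrite lt_def card_cube_neq0 ler0n.
(* With [t] the mean of [h (f x)], the minorant [2 t E h - t^2] equals [(E h)^2]. *)
have : 0 <= \sum_x (s2 * h (f x) ^+ 2 + (1 + s2) * t ^+ 2
    - (1 + s2) * (2 * t) * h (f x)).
  apply: (@sum_ge0_centred_two_point R _ f
    (fun u => s2 * h u ^+ 2 + (1 + s2) * t ^+ 2 - (1 + s2) * (2 * t) * h u)) => //.
  by move=> a c a0 c0; have /= := two_point_signed_powR R p t a c p1 a0 c0;
    rewrite -/s2 -/h; lra.
rewrite sumrB big_split /= sumr_const -!mulr_sumr tN.
under eq_bigr do rewrite sqr_signed_powR_half //.
rewrite -mulr_natr -/N => H; rewrite /mean mulrA ler_pdivlMr //; lra.
Qed.

(** * Fourier analysis on the cube *)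

(** The sum factors as the product of the [x_i y_i + 1], each equal to [2] or [0]. *)
Lemma sum_walsh_mul (R : realType) (n : nat) (x y : cube n) :
  \sum_(S : {set 'I_n}) walsh R S x * walsh R S y =
  #|cube n|%:R * (x == y)%:R.
Proof.
have W S : walsh R S x * walsh R S y =
    \prod_i (if i \in S then cube_coord R x i * cube_coord R y i else 1).
  by rewrite -big_mkcond /= big_split.
under eq_bigr do rewrite W.
transitivity (\prod_i (cube_coord R x i * cube_coord R y i + 1)).
  by rewrite bigA_distr; apply: eq_bigl => S; rewrite inE.
have [<-|xy] := eqVneq x y.
  under eq_bigr do rewrite /cube_coord -signr_addb addbb.
  by rewrite prodr_const card_ffun card_bool natrX mulr1 card_ord.
have [i xyi] : exists i, x i != y i.
  by apply/existsP; apply: contraNT xy => /existsPn xy; apply/eqP/ffunP => i;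
    apply/eqP/negPn.
rewrite mulr0 (bigD1 i) //= /cube_coord -signr_addb.
by case: (x i) (y i) xyi => [] [] //= _; rewrite addNr mul0r.
Qed.

Lemma plancherel (R : realType) (n : nat) (f g : cube n -> R) :
  mean (fun x => f x * g x) = \sum_S fourier f S * fourier g S.
Proof.
have N0 := card_cube_neq0 R n.
have H S : fourier f S * fourier g S = (#|cube n|%:R ^- 2) *
   \sum_x \sum_y f x * g y * (walsh R S x * walsh R S y).
  rewrite /fourier /mean mulrACA -invfM -expr2 mulrC big_distrlr /=.
  by congr (_ * _); apply: eq_bigr => x _; apply: eq_bigr => y _; ring.
under eq_bigr do rewrite H.
rewrite -mulr_sumr exchange_big /=.
have K x : \sum_(S : {set 'I_n}) \sum_y f x * g y * (walsh R S x * walsh R S y) =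
    #|cube n|%:R * (f x * g x).
  rewrite exchange_big /= (bigD1 x) //= [X in _ + X]big1 => [|y yx].
    by rewrite -mulr_sumr sum_walsh_mul eqxx addr0 mulr1 mulrC.
  by rewrite -mulr_sumr sum_walsh_mul eq_sym (negbTE yx) !mulr0.
under [X in _ = _ * X]eq_bigr do rewrite K.
by rewrite -mulr_sumr /mean; field.
Qed.

Lemma fourier0 (R : realType) (n : nat) (f : cube n -> R) :
  fourier f set0 = mean f.
Proof.
by rewrite /fourier /mean; congr (_ / _); apply: eq_bigr => x _;
  rewrite /walsh big_set0 mulr1.
Qed.

Definition flip {n : nat} (i : 'I_n) (x : cube n) : cube n :=
  [ffun j => (j == i) (+) x j].

Lemma flipK (n : nat) (i : 'I_n) : involutive (flip i).
Proof. by move=> x; apply/ffunP => j; rewrite !ffunE addbA addbb. Qed.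

Lemma walsh_flip (R : realType) (n : nat) (i : 'I_n) (S : {set 'I_n}) (x : cube n) :
  walsh R S (flip i x) = (-1) ^+ (i \in S) * walsh R S x.
Proof.
rewrite /walsh /cube_coord.
under eq_bigr do rewrite ffunE signr_addb.
rewrite big_split /=; congr (_ * _).
have [iS|iS] := boolP (i \in S).
  by rewrite (bigD1 i) //= eqxx big1 ?mulr1 // => j /andP[_ /negbTE->].
by rewrite big1 // => j jS; case: eqP jS => [->|//]; rewrite (negbTE iS).
Qed.

Lemma fourier_diff (R : realType) (n : nat) (i : 'I_n) (f : cube n -> R)
    (S : {set 'I_n}) :
  fourier (fun x => f x - f (flip i x)) S = 2 * (i \in S)%:R * fourier f S.
Proof.
rewrite /fourier /mean mulrA; congr (_ / _).
under eq_bigr do rewrite mulrBl.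
rewrite sumrB [X in _ - X](reindex_inj (inv_inj (flipK n i))) /=.
under [X in _ - X]eq_bigr do rewrite flipK walsh_flip mulrCA.
by rewrite -mulr_sumr; case: (i \in S) => /=; ring.
Qed.

Lemma mean_mul_Lop (R : realType) (n : nat) (f g : cube n -> R) :
  mean (fun x => g x * Lop f x) =
  \sum_(S : {set 'I_n}) #|S|%:R * (fourier f S * fourier g S).
Proof.
rewrite /mean /Lop.
under eq_bigr do rewrite mulr_sumr.
rewrite exchange_big /= mulr_suml; apply: eq_bigr => S _.
rewrite {3}/fourier /mean !mulrA !mulr_sumr; congr (_ / _).
by apply: eq_bigr => x _; ring.
Qed.

(** By Plancherel, direction [i] contributes [4] times the coefficient product for each [S]
    containing [i]; summing over [i] produces [#|S|]. *)
Lemma dirichletE (R : realType) (n : nat) (f g : cube n -> R) :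
  mean (fun x => g x * Lop f x) =
  \sum_i mean (fun x => (f x - f (flip i x)) * (g x - g (flip i x))) / 4.
Proof.
rewrite mean_mul_Lop -mulr_suml.
under [in RHS]eq_bigr do rewrite plancherel.
rewrite exchange_big /= mulr_suml; apply: eq_bigr => S _.
under [in RHS]eq_bigr do rewrite !fourier_diff.
have H (i : 'I_n) : 2 * (i \in S)%:R * fourier f S * (2 * (i \in S)%:R * fourier g S) =
   (i \in S)%:R * (4 * (fourier f S * fourier g S)).
  by case: (i \in S) => /=; ring.
under eq_bigr do rewrite H.
by rewrite -mulr_suml -natr_sum -big_mkcond sum1_card; field.
Qed.

(** Subtracting the squared mean removes the empty set, and all other sets have weight
    [#|S| >= 1]. *)
Lemma poincare (R : realType) (n : nat) (h : cube n -> R) :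
  mean (fun x => h x ^+ 2) - mean h ^+ 2 <= mean (fun x => h x * Lop h x).
Proof.
have -> : mean (fun x => h x ^+ 2) = \sum_S fourier h S * fourier h S.
  exact: plancherel.
rewrite mean_mul_Lop (bigD1 set0) //= [leRHS](bigD1 set0) //= fourier0 cards0.
rewrite mul0r add0r expr2 [leLHS]addrC addKr.
apply: ler_sum => S S0; rewrite ler_peMl -?expr2 ?sqr_ge0 //.
by rewrite ler1n card_gt0.
Qed.

(** * Monotonicity of the mean and the final estimate *)

Lemma ler_mean (R : realType) (n : nat) (f g : cube n -> R) :
  (forall x, f x <= g x) -> mean f <= mean g.
Proof. by move=> fg; rewrite ler_wpM2r ?invr_ge0 ?ler0n // ler_sum. Qed.

Lemma meanZ (R : realType) (n : nat) (c : R) (f : cube n -> R) :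
  mean (fun x => c * f x) = c * mean f.
Proof. by rewrite /mean -mulr_sumr mulrA. Qed.

Theorem theorem1p6 (R : realType) (n : nat) (hn : (1 <= n)%N)
    (p : R) (hp : 1 < p) (f : cube n -> R) (hf : mean f = 0) :
  mean (fun x => `|f x| `^ (p - 1) * Num.sg (f x) * Lop f x)
    >= (2 * p - 2) / (p ^+ 2 - 2 * p + 2) * mean (fun x => `|f x| `^ p).
Proof.
pose h x := signed_powR (p / 2) (f x); pose s2 := ((p - 2) / p) ^+ 2.
have s20 : 0 <= s2 := sqr_ge0 _.
have s21 : 0 <= 1 - s2.
  rewrite subr_ge0 /s2 expr_div_n ler_pdivrMr ?exprn_gt0; nra.
have E : (1 - s2) * mean (fun x => h x * Lop h x) <=
    mean (fun x => `|f x| `^ (p - 1) * Num.sg (f x) * Lop f x).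
  rewrite (dirichletE R n h h) (dirichletE R n f (fun x => signed_powR (p - 1) (f x))).
  rewrite mulr_sumr; apply: ler_sum => i _.
  rewrite mulrA ler_pM2r ?invr_gt0 // -meanZ; apply: ler_mean => x.
  by rewrite -expr2 stroock_varopoulos.
have V := poincare R n h.
have M := sqr_mean_signed_powR R n p f hp hf.
have h2 : mean (fun x => h x ^+ 2) = mean (fun x => `|f x| `^ p).
  by rewrite /mean; congr (_ / _); apply: eq_bigr => x _; rewrite sqr_signed_powR_half.
rewrite h2 in V; apply: le_trans E.
have -> : (2 * p - 2) / (p ^+ 2 - 2 * p + 2) = (1 - s2) / (1 + s2).
  rewrite /s2; field; rewrite ?gt_eqF //=; nra.
rewrite -mulrA ler_wpM2l // mulrC ler_pdivrMr; last by lra.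
(* [(1 + s2) Var h >= (1 + s2) E h^2 - s2 E h^2 = E h^2]. *)
have := ler_wpM2l (addr_ge0 ler01 s20) V.
by move: M; rewrite -/s2 -/h; lra.
Qed.
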